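(* For every $n\ge 1$ there is a bijection $\Phi:\mathfrak{S}_n\to\mathfrak{S}_n$ such that for all $\sigma\in\mathfrak{S}_n$, $$(\operatorname{ndes}\sigma,\ \operatorname{fmax}\sigma,\ (31\text{-}2)\sigma,\ (2\text{-}31)\sigma,\ \operatorname{MAD}\sigma) = (\operatorname{wex}\tau,\ \operatorname{fix}\tau,\ \operatorname{cros}\tau,\ \operatorname{nest}\tau,\ \operatorname{inv}\tau),\quad \tau=\Phi(\sigma).$$
   Context: $\mathfrak{S}_n$ is the set of permutations $\sigma=\sigma_1\cdots\sigma_n$ of $[n]$. An index $i\in[n-1]$ with $\sigma_i>\sigma_{i+1}$ makes $\sigma_i$ a descent (top); $\operatorname{des}\sigma$ is the number of such $i$, and $\operatorname{ndes}\sigma=n-\operatorname{des}\sigma$ is the number of nondescents, i.e. entries $\sigma_i$ ($i\in[n]$, including $\sigma_n$) that are not descent tops. $\sigma_i$ is a left-to-right maximum if $\sigma_i=\max\{\sigma_1,\dots,\sigma_i\}$; $\operatorname{fmax}\sigma$ is the number of nondescents $\sigma_i$ that are left-to-right maxima. $(31\text{-}2)\sigma=\#\{(i,j): i+1<j,\ \sigma_i>\sigma_j>\sigma_{i+1}\}$; $(2\text{-}31)\sigma=\#\{(i,j): j<i-1,\ \sigma_{i-1}>\sigma_j>\sigma_i\}$; $\operatorname{MAD}\sigma=\operatorname{des}\sigma+(31\text{-}2)\sigma+2(2\text{-}31)\sigma$. Also $\operatorname{wex}\tau=\#\{i:\tau_i\ge i\}$, $\operatorname{fix}\tau=\#\{i:\tau_i=i\}$,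 $\operatorname{cros}\tau=\#\{(i,j): i<j\le\tau_i<\tau_j \text{ or } \tau_i<\tau_j<i<j\}$, $\operatorname{nest}\tau=\#\{(i,j): i<j\le\tau_j<\tau_i \text{ or } \tau_j<\tau_i<i<j\}$, $\operatorname{inv}\tau=\#\{(i,j):i<j,\ \tau_i>\tau_j\}$. *)

(* Defs.v *)
From mathcomp Require Import all_boot all_fingroup.
Set Implicit Arguments. Unset Strict Implicit. Unset Printing Implicit Defensive.

(* A permutation s : {perm 'I_n} is read as the word sigma_1 ... sigma_n with
   sigma_i = (s (i-1)) + 1 for i in [1..n]  (1-based positions and values). *)
Definition word (n : nat) (s : {perm 'I_n}) : seq nat :=
  [seq (s i).+1 | i <- enum 'I_n].
Definition pv (n : nat) (s : {perm 'I_n}) (i : nat) : nat := nth 0 (word s) i.-1.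

Definition idx (n : nat) : seq nat := iota 1 n.

Definition des (n : nat) (s : {perm 'I_n}) : nat :=
  count (fun i => pv s i.+1 < pv s i) (iota 1 n.-1).

Definition ndes (n : nat) (s : {perm 'I_n}) : nat := n - des s.

Definition is_desc (n : nat) (s : {perm 'I_n}) (i : nat) : bool :=
  (i < n) && (pv s i.+1 < pv s i).

Definition is_lrmax (n : nat) (s : {perm 'I_n}) (i : nat) : bool :=
  all (fun j => pv s j <= pv s i) (iota 1 i).

Definition fmax (n : nat) (s : {perm 'I_n}) : nat :=
  count (fun i => ~~ is_desc s i && is_lrmax s i) (idx n).

Definition p31_2 (n : nat) (s : {perm 'I_n}) : nat :=
  \sum_(i <- idx n) count (fun j => (i.+1 < j) && (pv s j < pv s i)
                                    && (pv s i.+1 < pv s j)) (idx n).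

Definition p2_31 (n : nat) (s : {perm 'I_n}) : nat :=
  \sum_(i <- idx n) count (fun j => (j < i.-1) && (pv s j < pv s i.-1)
                                    && (pv s i < pv s j)) (idx n).

Definition MAD (n : nat) (s : {perm 'I_n}) : nat :=
  des s + p31_2 s + 2 * p2_31 s.

Definition wex (n : nat) (t : {perm 'I_n}) : nat :=
  count (fun i => i <= pv t i) (idx n).

Definition fixp (n : nat) (t : {perm 'I_n}) : nat :=
  count (fun i => pv t i == i) (idx n).

Definition cros (n : nat) (t : {perm 'I_n}) : nat :=
  \sum_(i <- idx n) count (fun j =>
     ((i < j) && (j <= pv t i) && (pv t i < pv t j))
  || ((pv t i < pv t j) && (pv t j < i) && (i < j))) (idx n).

Definition nest (n : nat) (t : {perm 'I_n}) : nat :=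
  \sum_(i <- idx n) count (fun j =>
     ((i < j) && (j <= pv t j) && (pv t j < pv t i))
  || ((pv t j < pv t i) && (pv t i < i) && (i < j))) (idx n).

Definition invn (n : nat) (t : {perm 'I_n}) : nat :=
  \sum_(i <- idx n) count (fun j => (i < j) && (pv t j < pv t i)) (idx n).

(* Main.v *)
(* Let A and B be the sets of descent tops and descent bottoms of s, and let
   r v be the number of occurrences of 2-31 in which v plays the "2".  The
   image t of s sends A onto B with t i < i and the complement of A onto that
   of B with i <= t i, the Lehmer codes of the two pieces being given by r, so
   that v accounts for r v nestings of t.  For each letter v, both 31-2 plus
   2-31 for s and crossings plus nestings for t are counted by
   #{b in B, b < v} - #{a in A, a <= v}; hence crossings match 31-2.  The map is
   injective because (A, B, r) determines, letter by letter in increasing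
   order, the relative positions of the letters of s. *)
Require Import Defs.
From mathcomp Require Import all_boot all_fingroup zify.
Set Implicit Arguments. Unset Strict Implicit. Unset Printing Implicit Defensive.

(** * Passage from 1-based words to sums over ordinals *)

Lemma pvS n (s : {perm 'I_n}) (i : 'I_n) : pv s i.+1 = (s i).+1.
Proof. by rewrite /pv /word /= (nth_map i) ?size_enum_ord // nth_ord_enum. Qed.

Lemma sum_idx n (F : nat -> nat) : \sum_(i <- idx n) F i = \sum_(i < n) F i.+1.
Proof.
rewrite /idx -[in LHS](addn0 1) iotaDl big_map -(big_mkord xpredT (fun i => F i.+1)).
by rewrite /index_iota subn0.
Qed.

Lemma count_idx n (P : pred nat) : count P (idx n) = \sum_(i < n) P i.+1.
Proof.
rewrite -(sum_idx n (fun i => P i : nat)) -sum1_count big_mkcond.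
by apply: eq_bigr => i _; case: (P i).
Qed.

(** The successor [ordS] is cyclic, hence a bijection of positions that can be used for reindexing;
    the guard discards the wrap-around. *)
Definition descent n (s : {perm 'I_n}) (p : 'I_n) :=
  (p.+1 < n) && (s (ordS p) < s p).

Lemma val_ordS n (p : 'I_n) : p.+1 < n -> ordS p = p.+1 :> nat.
Proof. exact: modn_small. Qed.

Lemma pv_ordS n (s : {perm 'I_n}) (p : 'I_n) :
  p.+1 < n -> pv s p.+2 = (s (ordS p)).+1.
Proof. by move=> lt_p; rewrite -pvS val_ordS. Qed.

Lemma is_descE n (s : {perm 'I_n}) (p : 'I_n) : is_desc s p.+1 = descent s p.
Proof.
rewrite /is_desc /descent; case: ltnP => //= lt_p.
by rewrite pv_ordS // pvS.
Qed.

Lemma desE n (s : {perm 'I_n}) : des s = \sum_p descent s p.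
Proof.
case: n s => [|n] s; first by rewrite big_ord0.
under eq_bigr do rewrite -is_descE.
rewrite -(count_idx n.+1 (is_desc s)).
have -> : idx n.+1 = iota 1 n ++ [:: n.+1] by rewrite /idx -{1}(addn1 n) iotaD.
rewrite count_cat /= {2}/is_desc ltnn !addn0; apply: eq_in_count => i.
rewrite mem_iota => h.
by rewrite /is_desc (_ : i < n.+1) //; lia.
Qed.

(** * Descent tops, descent bottoms and patterns, letter by letter *)

Definition dtop n (s : {perm 'I_n}) v := descent s (s^-1%g v).
Definition dbot n (s : {perm 'I_n}) v := descent s (ord_pred (s^-1%g v)).
Definition straddle n (s : {perm 'I_n}) (v p : 'I_n) :=
  descent s p && (s (ordS p) < v < s p).
(* [rcode s v] and [lcode s v] count the occurrences of 2-31 and of 31-2 in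
   which the letter [v] plays the "2". *)
Definition rcode n (s : {perm 'I_n}) v :=
  \sum_p (straddle s v p && (s^-1%g v < p)).
Definition lcode n (s : {perm 'I_n}) v :=
  \sum_p (straddle s v p && (p < s^-1%g v)).

Lemma dtopE n (s : {perm 'I_n}) p : dtop s (s p) = descent s p.
Proof. by rewrite /dtop permK. Qed.

Lemma dbotE n (s : {perm 'I_n}) p : dbot s (s (ordS p)) = descent s p.
Proof. by rewrite /dbot permK ordSK. Qed.

Lemma reindex_top n (s : {perm 'I_n}) (F : 'I_n -> nat) :
  \sum_v F v = \sum_p F (s p).
Proof. exact: (reindex_inj (@perm_inj _ s)). Qed.

Lemma reindex_bot n (s : {perm 'I_n}) (F : 'I_n -> nat) :
  \sum_v F v = \sum_p F (s (ordS p)).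
Proof.
rewrite (reindex_top s) (reindex (@ordS n)) //.
by exists (@ord_pred n) => ? _; rewrite ?ordSK ?ord_predK.
Qed.

Lemma p31_2E n (s : {perm 'I_n}) : p31_2 s = \sum_v lcode s v.
Proof.
rewrite /p31_2 sum_idx [RHS]exchange_big /=; apply: eq_bigr => p _.
rewrite count_idx [RHS](reindex_top s); apply: eq_bigr => j _; rewrite permK.
congr nat_of_bool; rewrite /straddle /descent pvS.
have [lt_p|le_p] := ltnP p.+1 n; last by have := ltn_ord j; lia.
have e : ordS p = p.+1 :> nat by exact: val_ordS.
rewrite pv_ordS // pvS.
(* The pattern asks for [p.+1 < j], [lcode] only for [p < j]; strictness of [s (ordS p) < s j]
   excludes [j = p.+1]. *)
have : (j == p.+1 :> nat) = (s j == s (ordS p) :> nat).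
  by rewrite -e !val_eqE (inj_eq perm_inj).
lia.
Qed.

Lemma p2_31E n (s : {perm 'I_n}) : p2_31 s = \sum_v rcode s v.
Proof.
rewrite /p2_31 sum_idx [RHS]exchange_big /=.
rewrite (reindex (@ordS n)) /=; last first.
  by exists (@ord_pred n) => ? _; rewrite ?ordSK ?ord_predK.
apply: eq_bigr => p _.
rewrite count_idx [RHS](reindex_top s); apply: eq_bigr => j _; rewrite permK.
congr nat_of_bool; rewrite /straddle /descent.
have [lt_p|le_p] := ltnP p.+1 n.
  have e : p.+1 %% n = p.+1 by exact: val_ordS.
  have := pvS s (ordS p); rewrite /= e !pvS => ->; lia.
(* The wrap-around corresponds to the 1-based index 1, where no [j < 0] exists. *)
have -> : p.+1 %% n = 0.
  by have -> : p.+1 = n; [have := ltn_ord p; lia|rewrite modnn].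
by [].
Qed.

Lemma dtop_sum n (s : {perm 'I_n}) v :
  dtop s v = \sum_(p < n) (descent s p && (s p == v :> nat)) :> nat.
Proof.
rewrite (bigD1 (s^-1%g v)) //= permKV eqxx andbT big1 ?addn0 // => p ne_p.
by rewrite val_eqE (can2_eq (permK s) (permKV s)) (negbTE ne_p) andbF.
Qed.

(** Termwise over descents: if the bottom is below [v], the top is below [v], equal to [v], or above
    it; in the last case the descent lies to the right or to the left of [v]. *)
Lemma straddle_count n (s : {perm 'I_n}) v :
  rcode s v + lcode s v + \sum_(i < n) (dtop s i && (i < v)) + dtop s v
  = \sum_(i < n) (dbot s i && (i < v)).
Proof.
rewrite dtop_sum.
rewrite (reindex_top s (fun i => (dtop s i && (i < v) : nat))).
rewrite (reindex_bot s (fun i => (dbot s i && (i < v) : nat))).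
rewrite /rcode /lcode -!big_split; apply: eq_bigr => p _ /=.
rewrite dtopE dbotE /straddle /descent.
have : (p == s^-1%g v :> nat) = (s p == v :> nat).
  by rewrite !val_eqE (can2_eq (permK s) (permKV s)).
lia.
Qed.


(** * Recovering the word from its code *)

Lemma descend_below n (s : {perm 'I_n}) v (a b : 'I_n) :
  a < b -> v <= s a -> s b < v ->
  exists p : 'I_n, [/\ a <= p < b, v <= s p & s (ordS p) < v].
Proof.
have [m] := ubnP (b - a); elim: m => // m IH in a * => lt_m lt_ab v_a b_v.
have e : ordS a = a.+1 :> nat by apply: val_ordS; have := ltn_ord b; lia.
have [v_a'|a'_v] := leqP v (s (ordS a)); last by exists a; split=> //; lia.
have lt_a'b : ordS a < b.
  have : ordS a != b by apply: contraTneq v_a' => ->; lia.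
  by rewrite -val_eqE /=; move: e => /= ->; lia.
have [|p [h1 h2 h3]] := IH _ _ lt_a'b v_a' b_v; first by lia.
by exists p; split=> //; lia.
Qed.

(* The letters below [v] to the right of [v] start with a descent bottom whose
   top is at least [v]; so [u] comes after [v] iff fewer descents with
   [bottom < v <= top] lie to the right of [u] than to the right of [v].
   Those to the right of [u] are counted as descents with bottom below [v]
   minus descents with top below [v]. *)
Lemma after_code n (s : {perm 'I_n}) (u v : 'I_n) : u < v ->
  (s^-1%g v < s^-1%g u) =
  (\sum_i (dbot s i && (i < v) && (s^-1%g u < s^-1%g i)) <
   rcode s v + dtop s v + \sum_i (dtop s i && (i < v) && (s^-1%g u <= s^-1%g i))).
Proof.
move=> lt_uv.
pose E (k : 'I_n) := \sum_p (descent s p && (s (ordS p) < v <= s p) && (k <= p)).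
have -> : \sum_i (dbot s i && (i < v) && (s^-1%g u < s^-1%g i)) =
    E (s^-1%g u) + \sum_i (dtop s i && (i < v) && (s^-1%g u <= s^-1%g i)).
  rewrite (reindex_bot s
    (fun i => (dbot s i && (i < v) && (s^-1%g u < s^-1%g i) : nat))).
  rewrite (reindex_top s
    (fun i => (dtop s i && (i < v) && (s^-1%g u <= s^-1%g i) : nat))).
  rewrite -big_split; apply: eq_bigr => p _; rewrite dtopE dbotE !permK.
  rewrite /descent; case: ltnP => //= /val_ordS; rewrite /= => ->; lia.
have -> : rcode s v + dtop s v = E (s^-1%g v).
  rewrite dtop_sum.
  rewrite -big_split; apply: eq_bigr => p _ /=; rewrite /straddle /descent.
  have : (p == s^-1%g v :> nat) = (s p == v :> nat).
    by rewrite !val_eqE (can2_eq (permK s) (permKV s)).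
  lia.
rewrite ltn_add2r; case: ltnP => [lt_vu|le_uv]; symmetry.
  have [||p [h1 h2 h3]] := @descend_below _ s v _ _ lt_vu; rewrite ?permKV //.
  have lt_p : p.+1 < n by have := ltn_ord (s^-1%g u); lia.
  rewrite /E (bigD1 p) //= [X in _ < X](bigD1 p) //= -addSn.
  apply: leq_add; last by apply: leq_sum => q _; lia.
  by rewrite /descent; lia.
by apply/negbTE; rewrite -leqNgt; apply: leq_sum => q _; lia.
Qed.

Lemma perm_ltC n (r : {perm 'I_n}) (u v : 'I_n) :
  u < v -> (r u < r v) = ~~ (r v < r u).
Proof.
move=> lt_uv; rewrite -leqNgt ltn_neqAle val_eqE (inj_eq perm_inj).
by rewrite -val_eqE /= (ltn_eqF lt_uv).
Qed.

Lemma code_inj n (s t : {perm 'I_n}) :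
  dtop s =1 dtop t -> dbot s =1 dbot t -> rcode s =1 rcode t -> s = t.
Proof.
move=> eT eB eR.
(* Strong induction on the larger letter: the right-hand side of [after_code] only compares the
   position of [u] with those of letters below [v]. *)
have H (u v : 'I_n) : u < v -> (s^-1%g v < s^-1%g u) = (t^-1%g v < t^-1%g u).
  have [m] := ubnP v; elim: m => // m IH in u v * => lt_vm lt_uv.
  have C (i : 'I_n) : i < v -> (s^-1%g u < s^-1%g i) = (t^-1%g u < t^-1%g i).
    move=> lt_iv; case: (ltngtP u i) => [h|h|/val_inj ->]; last by rewrite !ltnn.
      by rewrite !(perm_ltC _ h) (IH _ _ (leq_trans lt_iv lt_vm) h).
    by apply: IH; lia.
  rewrite !after_code // eT eR; congr (_ < _ + _); apply: eq_bigr => i _.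
    by rewrite eB; case: (ltnP i v) => [/C ->|]; rewrite ?andbF.
  rewrite eT; case: (ltnP i v) => [/C|]; rewrite ?andbF // !andbT.
  have : (s^-1%g u == s^-1%g i :> nat) = (t^-1%g u == t^-1%g i :> nat).
    by rewrite !val_eqE !(inj_eq perm_inj).
  lia.
have G (u v : 'I_n) : (s^-1%g v < s^-1%g u) = (t^-1%g v < t^-1%g u).
  case: (ltngtP u v) => [|h|/val_inj ->]; [exact: H | | by rewrite !ltnn].
  by rewrite !(perm_ltC _ h) H.
(* A position is the number of positions before it, so relative order determines the permutation. *)
have rank (r : {perm 'I_n}) u : r u = \sum_v (r v < r u) :> nat.
  rewrite -(reindex_top r (fun i => (i < r u : nat))).
  rewrite -big_mkcond /= (big_ord_narrow (ltnW (ltn_ord (r u)))) /=.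
  by rewrite sum_nat_const card_ord muln1.
apply: invg_inj; apply/permP => u; apply: val_inj.
by rewrite /= (rank s^-1%g) (rank t^-1%g); apply: eq_bigr => v _; rewrite G.
Qed.

(** * Lehmer decoding with thresholds *)

Lemma exists_rank (T : finType) (B : {set T}) (w : T -> nat) k :
  {in B &, injective w} -> k < #|B| ->
  exists2 v, v \in B & #|[set u in B | w u < w v]| = k.
Proof.
elim: k B => [|k IH] B w_inj lt_kB.
  have [v0 Bv0] : exists v, v \in B by apply/set0Pn; rewrite -card_gt0.
  exists [arg min_(v < v0 in B) w v]; case: arg_minnP => // v Bv v_min //.
  apply: eq_card0 => u; rewrite !inE ltnNge.
  by case: (boolP (u \in B)) => //= /v_min ->.
have [v0 Bv0] : exists v, v \in B by apply/set0Pn; rewrite -card_gt0; lia.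
case: (@arg_minnP _ v0 [in B] w Bv0) => v1 /= Bv1 v1_min.
have [||v] := IH (B :\ v1).
- by move=> x y; rewrite !inE => /andP[_ Bx] /andP[_ By]; exact: w_inj.
- by have := cardsD1 v1 B; rewrite Bv1; lia.
rewrite !inE => /andP[v1v Bv] <-; exists v => //.
rewrite (cardsD1 v1) !inE Bv1 /=.
have -> : w v1 < w v.
  rewrite ltn_neqAle v1_min // andbT; apply: contraNneq v1v => e.
  by apply/eqP; exact: w_inj.
by rewrite add1n; congr _.+1; apply: eq_card => u; rewrite !inE andbA.
Qed.

(* Lehmer decoding: process [A] by increasing [p], sending [i] to the element
   of rank [c i] among the values of [B] still available; the counting
   hypothesis keeps that element below the threshold [b i]. *)
Lemma lehmer_decode (T : finType) (p w b c : T -> nat) (A B : {set T}) :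
  {in A &, injective p} -> {in B &, injective w} ->
  {in A &, forall i j, p i < p j -> b i <= b j} ->
  #|A| = #|B| ->
  {in A, forall i,
    c i + #|[set j in A | p j < p i]| < #|[set v in B | w v < b i]|} ->
  exists f : T -> T, [/\ {in A &, injective f}, f @: A = B,
    {in A, forall i, w (f i) < b i} &
    {in A, forall i, #|[set j in A | (p i < p j) && (w (f j) < w (f i))]| = c i}].
Proof.
have [m] := ubnP #|A|; elim: m => // m IH in A B *.
move=> lt_m p_inj w_inj b_mono eqAB hyp.
have [A0|[i0' Ai0']] := set_0Vmem A.
  have B0 : B = set0 by apply/eqP; rewrite -cards_eq0 -eqAB A0 cards0.
  by exists id; rewrite A0 B0 imset0; split=> // ?; rewrite inE.
case: (@arg_minnP _ i0' [in A] p Ai0') => i0 /= Ai0 i0_min {i0' Ai0'}.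
have lt_i0 i : i \in A -> i != i0 -> p i0 < p i.
  move=> Ai ne; rewrite ltn_neqAle i0_min // andbT; apply: contraNneq ne => e.
  by apply/eqP; apply: p_inj.
have c_i0 := leq_ltn_trans (leq_addr _ _) (hyp _ Ai0).
have [|v0 Bv0 rk_v0] := @exists_rank _ B w (c i0) w_inj.
  by apply: leq_trans c_i0 _; apply: subset_leq_card;
    apply/subsetP=> ?; rewrite inE => /andP[].
(* Otherwise all elements of [B] below [b i0] would precede [v0], too many for its rank [c i0]. *)
have lt_v0 : w v0 < b i0.
  rewrite ltnNge; apply: contraL c_i0 => le_b; rewrite -leqNgt -rk_v0.
  apply: subset_leq_card; apply/subsetP=> u; rewrite !inE => /andP[-> /=]; lia.
have [||||||f [f_inj fA f_lt f_c]] := IH (A :\ i0) (B :\ v0).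
- by have := cardsD1 i0 A; rewrite Ai0; lia.
- by move=> x y; rewrite !inE => /andP[_ Bx] /andP[_ By]; exact: p_inj.
- by move=> x y; rewrite !inE => /andP[_ Bx] /andP[_ By]; exact: w_inj.
- by move=> x y; rewrite !inE => /andP[_ Bx] /andP[_ By]; exact: b_mono.
- by have := cardsD1 i0 A; have := cardsD1 v0 B; rewrite Ai0 Bv0; lia.
(* Both cardinals drop by one: [i0] precedes [i], and [w v0 < b i0 <= b i]. *)
- move=> i; rewrite !inE => /andP[ne Ai]; have := hyp _ Ai.
  rewrite (cardsD1 i0) (cardsD1 v0 [set _ in _ | _]) !inE Ai0 Bv0 lt_i0 //=.
  rewrite (leq_trans lt_v0) ?b_mono ?lt_i0 //= addnCA ltn_add2l.
  by congr (_ + _ < _); apply: eq_card => u; rewrite !inE andbA.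
have fA_in i : i \in A -> i != i0 -> f i \in B :\ v0.
  by move=> Ai ne; rewrite -fA imset_f // !inE ne.
pose g i := if i == i0 then v0 else f i.
have g_i0 : g i0 = v0 by rewrite /g eqxx.
have gE i : i != i0 -> g i = f i by rewrite /g => /negbTE ->.
have g_inj : {in A &, injective g}.
  move=> x y Ax Ay; rewrite /g; case: eqVneq => [->|nx]; case: eqVneq => [->|ny] //.
  - by move=> e; have := fA_in _ Ay ny; rewrite -e !inE eqxx.
  - by move=> e; have := fA_in _ Ax nx; rewrite e !inE eqxx.
  - by apply: f_inj; rewrite !inE ?nx ?ny.
have gA : g @: A = B.
  apply/eqP; rewrite eqEcard (card_in_imset g_inj) eqAB leqnn andbT.
  apply/subsetP => _ /imsetP[i Ai ->]; case: (eqVneq i i0) => [->|ne].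
    by rewrite g_i0.
  by rewrite gE //; have := fA_in _ Ai ne; rewrite inE => /andP[].
exists g; split=> // i Ai; case: (eqVneq i i0) => [->|ne].
- by rewrite g_i0.
- by rewrite gE // f_lt // !inE ne.
(* [g] maps the set counted at [i0] bijectively onto the elements of [B] below [v0]. *)
- rewrite -rk_v0 -gA -[LHS](card_in_imset (f := g)); last first.
    by move=> x y; rewrite !inE => /andP[Ax _] /andP[Ay _]; apply: g_inj.
  apply: eq_card => u; rewrite inE; apply/imsetP/andP => [[j]|[/imsetP[j Aj ->]]].
    by rewrite !inE g_i0 => /and3P[Aj _ lt_j] ->; rewrite imset_f.
  move=> lt_j; exists j => //; rewrite !inE Aj g_i0 lt_j lt_i0 //.
  by apply: contraTneq lt_j => ->; rewrite g_i0 ltnn.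
- rewrite gE // -f_c ?inE ?ne //; apply: eq_card => j; rewrite !inE.
  case: (eqVneq j i0) => [->|nj] /=; last by rewrite gE.
  by rewrite Ai0 ltnNge ltnW ?lt_i0.
Qed.

(** * Crossings, nestings and inversions *)

(* A crossing or nesting pair [i < j] is attributed to [j] when both are weak
   excedances and to [i] when both are anti-excedances. *)
Definition nest_at n (t : {perm 'I_n}) (i : 'I_n) :=
  \sum_(j < n) ([&& j < i, i <= t i & t i < t j] + [&& t i < i, i < j & t j < t i]).
Definition cros_at n (t : {perm 'I_n}) (i : 'I_n) :=
  \sum_(j < n) ([&& j < i, i <= t j & t j < t i] + [&& t i < t j, t j < i & i < j]).

Lemma nestE n (t : {perm 'I_n}) : nest t = \sum_(i < n) nest_at t i.
Proof.
under [RHS]eq_bigr do rewrite /nest_at big_split /=.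
rewrite [RHS]big_split /= exchange_big /= -big_split /nest sum_idx.
apply: eq_bigr => i _; rewrite count_idx -big_split; apply: eq_bigr => j _ /=.
by rewrite !pvS; lia.
Qed.

Lemma crosE n (t : {perm 'I_n}) : cros t = \sum_(i < n) cros_at t i.
Proof.
under [RHS]eq_bigr do rewrite /cros_at big_split /=.
rewrite [RHS]big_split /= exchange_big /= -big_split /cros sum_idx.
apply: eq_bigr => i _; rewrite count_idx -big_split; apply: eq_bigr => j _ /=.
by rewrite !pvS; lia.
Qed.

Lemma wexE n (t : {perm 'I_n}) : wex t + \sum_(i < n) (t i < i) = n.
Proof.
rewrite /wex count_idx -big_split -[RHS]card_ord -sum1_card /=.
by apply: eq_bigr => i _; rewrite pvS; lia.
Qed.

Lemma perm_eq_val n (t : {perm 'I_n}) (i j : 'I_n) :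
  (t i == t j :> nat) = (i == j :> nat).
Proof. by rewrite !val_eqE (inj_eq perm_inj). Qed.

(** The counterpart of [straddle_count], with anti-excedance positions and values in place of
    descent tops and bottoms. *)
Lemma cros_nest_count n (t : {perm 'I_n}) i :
  cros_at t i + nest_at t i + \sum_(j < n) ((t j < j) && (j < i)) + (t i < i)
  = \sum_(j < n) ((t j < j) && (t j < i)).
Proof.
rewrite /cros_at /nest_at -!big_split /=; case: (ltnP (t i) i) => [lt_ti|le_it].
  have -> : true = \sum_(j < n) (j == i :> nat) :> nat.
    by rewrite (bigD1 i) //= eqxx big1 // => j; rewrite -val_eqE /= => /negbTE ->.
  rewrite -big_split; apply: eq_bigr => j _ /=.
  by have := perm_eq_val t j i; lia.
(* For a weak excedance the identity becomes termwise only after adding these two equal sums, one to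
   each side. *)
have E : \sum_(j < n) (t j < i) = \sum_(j < n) (j < i).
  by rewrite (reindex_top t (fun j => (j < i : nat))).
rewrite addn0; apply/eqP; rewrite -(eqn_add2r (\sum_(j < n) (t j < i))) {2}E.
rewrite -!big_split; apply/eqP; apply: eq_bigr => j _ /=.
by have := perm_eq_val t j i; lia.
Qed.

(** An inversion between two weak excedances or two anti-excedances is a nesting. The others,
    counted by [M], pair a weak excedance with a later anti-excedance; [cros_nest_count] summed over
    [i] evaluates them. *)
Lemma invnE n (t : {perm 'I_n}) :
  invn t = \sum_(i < n) (t i < i) + cros t + 2 * nest t.
Proof.
pose M := \sum_(i < n) \sum_(j < n) [&& i < j, i <= t i, t j < j & t j < t i].
have -> : invn t = nest t + M.
  rewrite /invn /nest !sum_idx -big_split; apply: eq_bigr => i _.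
  rewrite !count_idx -big_split; apply: eq_bigr => j _ /=.
  by rewrite !pvS; lia.
suff -> : M = \sum_(i < n) (t i < i) + cros t + nest t by lia.
have C : cros t + nest t + \sum_(i < n) \sum_(j < n) ((t j < j) && (j < i))
           + \sum_(i < n) (t i < i)
         = \sum_(i < n) \sum_(j < n) ((t j < j) && (t j < i)).
  rewrite nestE crosE -!big_split; apply: eq_bigr => i _.
  exact: cros_nest_count.
suff : M + \sum_(i < n) \sum_(j < n) ((t j < j) && (j < i))
         = \sum_(i < n) \sum_(j < n) ((t j < j) && (t j < i)) by lia.
rewrite /M exchange_big [in X in _ + X = _]exchange_big [RHS]exchange_big /=.
(* Inversions between two anti-excedances, counted from either end; they cancel
   when [j - t j = #{i < j} - #{i | t i < t j}] is summed over anti-excedances. *)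
pose X := \sum_(j < n) \sum_(i < n) [&& t j < j, i < j, t i < i & t j < t i].
have XE : X = \sum_(j < n) \sum_(i < n) [&& t j < j, j < i & t i < t j].
  rewrite /X exchange_big; apply: eq_bigr => i _; apply: eq_bigr => j _ /=; lia.
apply/eqP; rewrite -(eqn_add2r X) {2}XE -!big_split; apply/eqP.
apply: eq_bigr => j _ /=.
rewrite (reindex_top t (fun i => ((t j < j) && (t j < i) : nat))) -!big_split.
by apply: eq_bigr => i _ /=; have := perm_eq_val t j i; lia.
Qed.

(** * Fixed points and left-to-right maxima *)

(** If the conditions on the right hold but [i] is not fixed, then [t^-1 i < i < t i], which is a
    crossing at [i]. *)
Lemma fixed_point_code n (t : {perm 'I_n}) i :
  (t i == i) = [&& i <= t i, t^-1%g i <= i & cros_at t i == 0].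
Proof.
apply/eqP/and3P => [ti|[le1 le2]].
  have -> : t^-1%g i = i by rewrite -{1}ti permK.
  rewrite ti leqnn; split=> //; rewrite /cros_at big1 // => j _; rewrite ti; lia.
rewrite /cros_at sum_nat_eq0 => /forallP/(_ (t^-1%g i)) /=.
rewrite permKV leqnn /= => H; apply: val_inj; apply/eqP => /=.
have := perm_eq_val t (t^-1%g i) i; rewrite permKV; lia.
Qed.

(** If a larger letter precedes [s p], then [descend_below] with threshold [(s p).+1] yields a
    descent before [p] from above [s p] to at most [s p]: its bottom is [s p] itself, or it forms a
    31-2 with [s p]. *)
Lemma lrmaxE n (s : {perm 'I_n}) (p : 'I_n) :
  is_lrmax s p.+1 = ~~ dbot s (s p) && (lcode s (s p) == 0).
Proof.
apply/allP/andP => [H|[nbot]].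
  have {}H (q : 'I_n) : q <= p -> s q <= s p.
    by move=> le_qp; have := H q.+1; rewrite !pvS mem_iota ltnS; apply; lia.
  split.
    rewrite /dbot permK /descent ord_predK; apply/negP => /andP[lt_q].
    have e := val_ordS lt_q; rewrite ord_predK in e.
    by have := H (ord_pred p); rewrite e; lia.
  rewrite sum_nat_eq0; apply/forallP => q; rewrite permK /straddle.
  by have := H q; lia.
rewrite sum_nat_eq0 => /forallP H j; rewrite mem_iota => j_range.
have lt_jn : j.-1 < n by have := ltn_ord p; lia.
have -> : j = (Ordinal lt_jn).+1 by rewrite /=; lia.
move: (Ordinal lt_jn) (erefl : Ordinal lt_jn = j.-1 :> nat) => k ek.
rewrite !pvS ltnS leqNgt; apply/negP => lt_pk.
have lt_kp : k < p.
  rewrite ltn_neqAle; apply/andP; split; last by lia.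
  by rewrite -(perm_eq_val s); lia.
have [q [/andP[_ q_p] q_v qS_v]] := descend_below lt_kp lt_pk (ltnSn _).
have lt_q : q.+1 < n by have := ltn_ord p; lia.
have := H q; rewrite permK /straddle /descent lt_q q_p.
have [e|ne] := eqVneq (ordS q) p.
  by move: nbot; rewrite -e dbotE /descent lt_q e; lia.
have : s (ordS q) != s p :> nat by rewrite val_eqE (inj_eq perm_inj).
lia.
Qed.

Lemma card_set_ord n (P : pred 'I_n) : #|[set x | P x]| = \sum_(x < n) P x.
Proof.
rewrite -sum1_card big_mkcond.
by apply: eq_bigr => x _; rewrite inE; case: (P x).
Qed.

(** * Construction of the image and proof of the theorem *)

Lemma exists_nest_code n (s : {perm 'I_n}) : exists t : {perm 'I_n},
  [/\ forall i, (t i < i) = dtop s i, forall i, dbot s (t i) = dtop s i &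
    forall i, nest_at t i = rcode s i].
Proof.
pose A := [set v | dtop s v]; pose B := [set v | dbot s v].
have eqAB : #|A| = #|B|.
  rewrite !card_set_ord (reindex_top s (fun v => (dtop s v : nat))).
  rewrite (reindex_bot s (fun v => (dbot s v : nat))).
  by apply: eq_bigr => p _; rewrite dtopE dbotE.
have eqABC : #|~: A| = #|~: B| by have := cardsC A; have := cardsC B; lia.
have val_in (D : {set 'I_n}) : {in D &, injective (fun i : 'I_n => i : nat)}.
  by move=> x y _ _; exact: val_inj.
have rev_in (D : {set 'I_n}) : {in D &, injective (fun i : 'I_n => n - i)}.
  by move=> x y _ _ /= e; apply: val_inj; have := ltn_ord x;
    have := ltn_ord y; move=> /=; lia.
have [||f [f_inj fA f_lt f_c]] := lehmer_decode (b := fun i : 'I_n => i : nat)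
   (c := rcode s) (val_in A) (val_in B) _ eqAB.
- by move=> i j _ _; lia.
- move=> i; rewrite inE => Ai; have := straddle_count s i; rewrite Ai.
  have -> : [set j in A | j < i] = [set j | dtop s j && (j < i)].
    by apply/setP => j; rewrite !inE.
  have -> : [set j in B | j < i] = [set j | dbot s j && (j < i)].
    by apply/setP => j; rewrite !inE.
  rewrite !card_set_ord => <-; by rewrite addn1 ltnS leq_add2r leq_addr.
(* The complements are decoded in reversed order; the threshold [(n - i).+1] makes [w (g i) < b i]
   mean [i <= g i]. *)
have [||g [g_inj gA g_lt g_c]] := lehmer_decode (b := fun i : 'I_n => (n - i).+1)
   (c := rcode s) (rev_in (~: A)) (rev_in (~: B)) _ eqABC.
- by move=> i j _ _; lia.
- move=> i; rewrite !inE => nAi; have := straddle_count s i; rewrite (negbTE nAi).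
  have -> : [set j in ~: A | n - j < n - i] = [set j | ~~ dtop s j && (i < j)].
    by apply/setP => j; rewrite !inE; have := ltn_ord j; lia.
  have -> : [set j in ~: B | n - j < (n - i).+1] = [set j | ~~ dbot s j && (i <= j)].
    by apply/setP => j; rewrite !inE; have := ltn_ord j; lia.
  rewrite !card_set_ord.
  (* Both sides count the letters from [i] on. With [#|A| = #|B|] this carries [straddle_count] over
     to the complements. *)
  have E1 : \sum_(j < n) (~~ dbot s j && (i <= j))
    + \sum_(j < n) (dbot s j && (i <= j)) =
    (\sum_(j < n) (~~ dtop s j && (i < j)) + \sum_(j < n) (dtop s j && (i < j))).+1.
    rewrite -!big_split /= (bigD1 i) //= [in RHS](bigD1 i) //= leqnn ltnn.
    rewrite !andbF !andbT add0n -addn1 addnC; congr (_ + _); last by case: dbot.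
    by apply: eq_bigr => j; rewrite -val_eqE /=; lia.
  have E2 : \sum_(j < n) dtop s j =
    \sum_(j < n) (dtop s j && (j < i)) + \sum_(j < n) (dtop s j && (i < j)).
    rewrite -!big_split; apply: eq_bigr => j _ /=.
    by case: (ltngtP j i) => [||/val_inj ->]; rewrite ?(negbTE nAi) //; lia.
  have E3 : \sum_(j < n) dbot s j =
    \sum_(j < n) (dbot s j && (j < i)) + \sum_(j < n) (dbot s j && (i <= j)).
    by rewrite -!big_split; apply: eq_bigr => j _ /=; lia.
  move: eqAB; rewrite !card_set_ord; lia.
pose h i := if dtop s i then f i else g i.
have hB i : dbot s (h i) = dtop s i.
  rewrite /h; case: ifP => Ai.
    by have : f i \in B; [rewrite -fA imset_f ?inE | rewrite inE].
  have : g i \in ~: B by rewrite -gA imset_f ?inE ?Ai.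
  by rewrite !inE => /negbTE.
have h_inj : injective h.
  move=> x y e; have := hB x; rewrite e hB => exy; move: e; rewrite /h exy.
  case: ifP => Ax; first by apply: f_inj; rewrite inE ?exy ?Ax.
  by apply: g_inj; rewrite !inE ?exy ?Ax.
have h_lt i : (h i < i) = dtop s i.
  rewrite /h; case: ifP => Ai; first by apply: f_lt; rewrite inE.
  by have := g_lt i; rewrite !inE Ai => /(_ isT);
    have := ltn_ord i; have := ltn_ord (g i); lia.
exists (perm h_inj); split=> i; rewrite ?permE //.
rewrite /nest_at; under eq_bigr do rewrite !permE.
(* A [j] counted in [nest_at] at [i] is always of the same type as [i], so [f] and [g] separate. *)
case: (boolP (dtop s i)) => Ai; [rewrite -f_c ?inE //|rewrite -g_c ?inE //].
  rewrite card_set_ord; apply: eq_bigr => j _; have := h_lt i; have := h_lt j.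
  by rewrite inE /h Ai; case: ifP => Aj; lia.
rewrite card_set_ord; apply: eq_bigr => j _; have := h_lt i; have := h_lt j.
rewrite !inE /h (negbTE Ai); have := ltn_ord j; have := ltn_ord i.
by have := ltn_ord (g i); have := ltn_ord (g j); case: ifP => Aj; lia.
Qed.

Theorem theorem3p1 (n : nat) : 1 <= n ->
  exists Phi : {perm 'I_n} -> {perm 'I_n}, bijective Phi /\
    forall s : {perm 'I_n},
      (ndes s, fmax s, p31_2 s, p2_31 s, MAD s) =
      (wex (Phi s), fixp (Phi s), cros (Phi s), nest (Phi s), invn (Phi s)).
Proof.
move=> _; have [Phi PhiP] := fin_all_exists (@exists_nest_code n).
exists Phi; split=> [|s].
  (* On a finite set injectivity suffices; [Phi s] returns [dtop s] as its anti-excedances, [dbot s]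
     as their values and [rcode s] as its nestings. *)
  apply: injF_bij => s1 s2 e.
  have [lt1 bot1 nest1] := PhiP s1; have [lt2 bot2 nest2] := PhiP s2.
  apply: code_inj => i.
  - by rewrite -lt1 -lt2 e.
  - by rewrite -(permKV (Phi s1) i) bot1 {2}e bot2 -lt1 -lt2 e.
  - by rewrite -nest1 -nest2 e.
have [ltP botP nestP] := PhiP s; set t := Phi s in ltP botP nestP *.
have crosP i : cros_at t i = lcode s i.
  have eB : \sum_(j < n) (dbot s j && (j < i)) =
    \sum_(j < n) ((t j < j) && (t j < i)).
    rewrite (reindex_top t (fun v => (dbot s v && (v < i) : nat))).
    by apply: eq_bigr => j _; rewrite botP ltP.
  have eT : \sum_(j < n) (dtop s j && (j < i)) =
    \sum_(j < n) ((t j < j) && (j < i)).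
    by apply: eq_bigr => j _; rewrite ltP.
  have := cros_nest_count t i; have := straddle_count s i.
  rewrite eB eT nestP ltP; lia.
have desP : des s = \sum_(i < n) (t i < i).
  rewrite desE; under [RHS]eq_bigr do rewrite ltP.
  by rewrite (reindex_top s (fun v => (dtop s v : nat)));
    apply: eq_bigr => p _; rewrite dtopE.
have cP : p31_2 s = cros t.
  by rewrite p31_2E crosE; apply: eq_bigr => i _; rewrite crosP.
have nP : p2_31 s = nest t.
  by rewrite p2_31E nestE; apply: eq_bigr => i _; rewrite nestP.
have fP : fmax s = fixp t.
  rewrite /fmax /fixp !count_idx.
  (* [t^-1 i <= i] says that [i] is not the value of an anti-excedance, that is, not a descent
     bottom of [s]. *)
  have F (i : 'I_n) : (pv t i.+1 == i.+1) =
      [&& ~~ dtop s i, ~~ dbot s i & lcode s i == 0].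
    rewrite pvS eqSS val_eqE fixed_point_code crosP leqNgt ltP; congr [&& _, _ & _].
    by rewrite leqNgt -{1}(permKV t i) ltP -botP permKV.
  under [RHS]eq_bigr do rewrite F.
  rewrite [RHS](reindex_top s); apply: eq_bigr => p _.
  by rewrite is_descE lrmaxE dtopE.
rewrite fP cP nP /MAD cP nP desP invnE /ndes desP.
by have w := wexE t; congr (_, _, _, _, _); lia.
Qed.
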